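(* Let $\tau>0$ and $g_0\in[0,1]$, and consider the transmission protocol with one-bit channel state feedback and parameters $(\tau,g_0)$ described in the context. As $K\to\infty$, it achieves the wideband minimum energy per nat $$\bar{\eta}=\left[\tau+1-\frac{g_0\tau}{1-\exp(-\tau)}\right]^{-1}.$$
   Context: Setting (one-bit feedback protocol over $K$ i.i.d. parallel scalar Rayleigh fading channels). Channel $k$ is $Y_k=H_kX_k+Z_k$ with $Z_k\sim\mathcal{CN}(0,1)$ and $|H_k|^2$ i.i.d. exponential with mean 1. The transmitter is told $F_k=0$ if $|H_k|^2\le\tau$ and $F_k=1$ otherwise. Let $p_0=\Pr[F_k=0]=1-e^{-\tau}$, $p_1=e^{-\tau}$, let $K_0$ be the number of channels with $F_k=0$, and $K_1=K-K_0$. Let $g_1=1-g_0$ and let $\rho>0$ be the total power. Each channel with $F_k=0$ receives power $g_0\rho/K_0$ and each channel with $F_k=1$ receives power $g_1\rho/K_1$ (if $K_0=0$ or $K_1=0$ the corresponding power $g_0\rho$ or $g_1\rho$ is wasted). The total achievable rate (in nats) is the random variable $$R(K,\rho)=\sum_{i=1}^{K_0}\log\left(1+\frac{g_0\rho}{K_0}A_i^{(0)}\right)+\sum_{j=1}^{K_1}\log\left(1+\frac{g_1\rho}{K_1}A_j^{(1)}\right)$$ (an empty sum is $0$), where $K_0\sim\mathrm{Binomial}(K,p_0)$, $A^{(0)}_1,A^{(0)}_2,\ldots$ are i.i.d. with density $e^{-x}/p_0$ on $[0,\tau]$, $A^{(1)}_1,A^{(1)}_2,\ldots$ are i.i.d.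 with density $e^{-x}/p_1$ on $(\tau,\infty)$, and $K_0$ and these two sequences are independent. The wideband minimum energy per nat $\bar\eta$ is the deterministic number such that $R(K,\rho)\to\rho/\bar\eta$ in probability as $K\to\infty$. All logarithms are natural. *)

(* Defs.v *)
From HB Require Import structures.
From mathcomp Require Import all_boot all_order all_algebra finmap.
From mathcomp Require Import all_classical all_reals all_analysis.

Set Implicit Arguments.
Unset Strict Implicit.
Unset Printing Implicit Defensive.

Import Order.TTheory GRing.Theory Num.Theory.
Import numFieldNormedType.Exports.

Local Open Scope classical_set_scope.
Local Open Scope ring_scope.

Section probability_notions.
Context {d : measure_display} {T : measurableType d} {R : realType}.
Variable P : probability T R.

Definition sigma_of {d' : measure_display} {T' : measurableType d'}
    (X : {RV P >-> T'}) : set_system T :=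
  preimage_set_system setT X measurable.

(* The systems of events are indexed explicitly so that random variables with
   different codomains can belong to the same independent family. *)
Definition mutually_independent {I : choiceType} (F : I -> set_system T) :=
  forall (J : {fset I}) (E : I -> set T),
    (forall i, i \in J -> F i (E i)) ->
    P (\bigcap_(i in [set` J]) E i) = (\prod_(i <- J) P (E i))%E.

Definition has_density (X : {RV P >-> R}) (f : R -> R) :=
  forall B : set R, measurable B ->
    distribution P X B = (\int[lebesgue_measure]_(x in B) (f x)%:E)%E.

Definition cvg_in_probability (X : nat -> T -> R) (l : R) :=
  forall e : R, 0 < e ->
    P [set w | e < `|X n w - l|] @[n --> \oo] --> (0 : \bar R).

End probability_notions.

Section one_bit_feedback.
Context {R : realType}.

Definition p0 (tau : R) : R := 1 - expR (- tau).
Definition p1 (tau : R) : R := expR (- tau).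

Definition density0 (tau : R) : R -> R :=
  (fun x => expR (- x) / p0 tau) \_ `[0, tau].
Definition density1 (tau : R) : R -> R :=
  (fun x => expR (- x) / p1 tau) \_ `]tau, +oo[.

Context {d : measure_display} {T : measurableType d}.
Variable P : probability T R.

(* Index [inl tt] is the channel count; [inr (inl i)] and [inr (inr j)] are the
   gains of the channels fed back as 0 and as 1. *)
Definition protocol_events (N : {RV P >-> nat}) (A0 A1 : nat -> {RV P >-> R})
    (i : (unit + (nat + nat))%type) : set_system T :=
  match i with
  | inl _ => sigma_of N
  | inr (inl i) => sigma_of (A0 i)
  | inr (inr j) => sigma_of (A1 j)
  end.

(* [N K] is the number K_0 of channels fed back as 0 among K. As [N K <= K]
   almost surely, the truncated [K - N K] is K_1. Gains are numbered from 0.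
   A zero count gives an empty sum, so the value of [_ / 0] never matters. *)
Definition total_rate (g0 : R) (N : nat -> {RV P >-> nat})
    (A0 A1 : nat -> {RV P >-> R}) (rho : R) (K : nat) (w : T) : R :=
  \sum_(i < N K w) ln (1 + g0 * rho / (N K w)%:R * A0 i w) +
  \sum_(j < (K - N K w)%N)
     ln (1 + (1 - g0) * rho / (K - N K w)%N%:R * A1 j w).

Definition wideband_min_energy_per_nat (g0 : R) (N : nat -> {RV P >-> nat})
    (A0 A1 : nat -> {RV P >-> R}) (eta : R) :=
  0 < eta /\
  forall rho : R, 0 < rho ->
    cvg_in_probability P (total_rate g0 N A0 A1 rho) (rho / eta).

End one_bit_feedback.

(* Main.v *)
(* Condition on [K_0 = k]. By independence, the gains of the k channels fed back
   as 0 remain pairwise independent and keep their law, and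
   [x - x^2 <= ln (1 + x) <= x] reduces the sum of the k logarithms to
   [c / k] times the sum of the gains, up to [(c / k)^2] times the sum of their
   squares. Chebyshev's and Markov's inequalities then bound the conditional
   probability of a deviation by [C / (k + 1)]. Averaging over [k] is exact for
   the binomial law, since
   [C(K, k) / (k + 1) = C(K + 1, k + 1) / (K + 1)] gives
   [E (1 / (K_0 + 1)) <= 1 / ((K + 1) p_0)], and likewise for [K_1] and [p_1].
   Hence the rate tends in probability to
   [rho (g_0 E A^(0) + g_1 E A^(1))], with [E A^(1) = tau + 1] and
   [E A^(0) = 1 - tau p_1 / p_0]. *)
Require Import Defs.
From HB Require Import structures.
From mathcomp Require Import all_boot all_order all_algebra finmap.
From mathcomp Require Import all_classical all_reals all_analysis.
From mathcomp Require Import measurable_realfun ring lra.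

Set Implicit Arguments.
Unset Strict Implicit.
Unset Printing Implicit Defensive.

Import Order.TTheory GRing.Theory Num.Theory.
Import numFieldNormedType.Exports.

Local Open Scope classical_set_scope.
Local Open Scope ring_scope.

(** * Integration against a density *)

Section density.
Context {d : measure_display} {T : measurableType d} {R : realType}.
Variables (nu mu : {measure set T -> \bar R}) (g : T -> R).
Hypothesis mg : measurable_fun setT g.
Hypothesis g0 : forall x, 0 <= g x.
Hypothesis nuE : forall B, measurable B ->
  nu B = (\int[mu]_(x in B) (g x)%:E)%E.

Import HBNNSimple.

Local Open Scope ereal_scope.

(** A simple function is a finite combination of indicators of its level sets, so linearity of both
    integrals reduces the claim to [nuE] on each level set. *)
Lemma integral_density_nnsfun (f : {nnsfun T >-> R}) :
  \int[nu]_x (f x)%:E = \int[mu]_x ((f x)%:E * (g x)%:E).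
Proof.
under [LHS]eq_integral do rewrite fimfunE -fsumEFin//.
rewrite [LHS]ge0_integral_fsum//; last 2 first.
  - by move=> r; exact/measurable_EFinP/measurableT_comp.
  - by move=> n x _; rewrite EFinM nnfun_muleindic_ge0.
under [RHS]eq_integral.
  move=> x xD; rewrite fimfunE -fsumEFin// ge0_mule_fsuml; last first.
    by move=> r; rewrite EFinM nnfun_muleindic_ge0.
  over.
rewrite [RHS]ge0_integral_fsum//; last 2 first.
  - move=> r; apply: emeasurable_funM; apply/measurable_EFinP => //.
    exact: measurable_funM.
  - move=> r x _; apply: mule_ge0; last by rewrite lee_fin.
    by rewrite EFinM nnfun_muleindic_ge0.
apply: eq_fsbigr => r _.
have mr : measurable (f @^-1` [set r]) by exact: measurable_sfunP.
rewrite integralZl_indic_nnsfun// integral_indic// setIT nuE//.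
(* A negative [r] has an empty level set, so both sides vanish; what remains is a nonnegative scalar
   to pull out of the integral. *)
have [r0|r0] := leP 0%R r; last first.
  rewrite preimage_nnfun0// integral_set0 mule0 integral0_eq// => x _.
  by rewrite indic0 mulr0 mul0e.
rewrite integral_mkcond -ge0_integralZl//=.
- apply: eq_integral => x _; rewrite patchE indicE.
  by case: ifPn => _; rewrite ?mulr1// mulr0 mule0 mul0e.
- apply/(measurable_restrictT _ _).1 => //.
  exact/measurable_EFinP/measurable_funTS.
- by move=> x _; rewrite patchE; case: ifPn => // _; rewrite lee_fin.
Qed.

(** Monotone convergence is applied twice, under [nu] and under [mu]: as [g] is nonnegative, its
    products with the increasing simple approximations of [f] increase too. *)
Lemma ge0_integral_density (f : T -> \bar R) :
  measurable_fun setT f -> (forall x, 0 <= f x) ->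
  \int[nu]_x f x = \int[mu]_x (f x * (g x)%:E).
Proof.
move=> mf f0.
pose f_ := nnsfun_approx measurableT mf.
transitivity (lim (\int[nu]_x (f_ n x)%:E @[n --> \oo])).
  rewrite -monotone_convergence//=.
  - apply: eq_integral => ? /[!inE] xD; apply/esym/cvg_lim => //=.
    exact: cvg_nnsfun_approx.
  - by move=> n; exact/measurable_EFinP/measurable_funTS.
  - by move=> n ? _; rewrite lee_fin.
  - by move=> ? _ ? ? mn; rewrite lee_fin; exact/lefP/nd_nnsfun_approx.
under eq_fun do rewrite integral_density_nnsfun.
rewrite -monotone_convergence//=.
- apply: eq_integral => x _; apply/cvg_lim => //=.
  apply: cvgeZr => //.
  exact: cvg_nnsfun_approx.
- move=> n; apply: emeasurable_funM; apply/measurable_EFinP => //.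
- by move=> n x _; rewrite mule_ge0// lee_fin.
- move=> x _ ? ? mn; rewrite lee_wpmul2r ?lee_fin//.
  exact/lefP/nd_nnsfun_approx.
Qed.

End density.

(** * Quadratic polynomials times exp(-x) *)

Section quadratic_exponential.
Context {R : realType}.
Notation mu := (@lebesgue_measure R).
Implicit Types a b c x : R.

(* The primitive of (a x^2 + b x + c) exp(-x), up to sign. *)
Definition quadexp a b c x :=
  (a * x ^+ 2 + (b + 2 * a) * x + (b + 2 * a + c)) * expR (- x).

Lemma is_derive_quadexp a b c x :
  is_derive x 1 (fun y => - quadexp a b c y)
    ((a * x ^+ 2 + b * x + c) * expR (- x)).
Proof.
rewrite /quadexp; apply: is_derive_eq.
rewrite /GRing.scale /=.
ring.
Qed.

Lemma continuous_quadexp a b c :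
  continuous (fun x => (a * x ^+ 2 + b * x + c) * expR (- x)).
Proof.
move=> x; apply: differentiable_continuous; apply/derivable1_diffP.
exact: ex_derive.
Qed.

(** Half of the exponential absorbs the polynomial, which squeezes [quadexp a b c x] between 0 and
    [16 * (a + b + c) * expR (- (2^-1 * x))]. *)
Lemma cvg_quadexp a b c : 0 <= a -> 0 <= b -> 0 <= c ->
  - quadexp a b c x @[x --> +oo] --> 0.
Proof.
move=> a0 b0 c0.
have cvgB : 16 * (a + b + c) * expR (- (2^-1 * x)) @[x --> +oo] --> 0.
  rewrite -[0](mulr0 (16 * (a + b + c))); apply: cvgM; first exact: cvg_cst.
  apply: (@cvg_comp _ _ _ (fun x => 2^-1 * x) (fun x => expR (- x))).
    by apply: gt0_cvgMry.
  exact: cvgr_expR.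
suff : quadexp a b c x @[x --> +oo] --> 0 by move/cvgN; rewrite oppr0.
apply: (@squeeze_cvgr _ _ _ _ (cst 0) _ _ _ 0 _ cvgB); last exact: cvg_cst.
near=> x.
have x0 : 0 <= x by near: x; apply: nbhs_pinfty_ge; rewrite num_real.
have e0 := expR_ge0 (- (2^-1 * x)).
rewrite /quadexp /=; apply/andP; split.
  by do ?[apply: addr_ge0|apply: mulr_ge0|apply: exprn_ge0|exact: expR_ge0].
have -> : - x = - (2^-1 * x) + - (2^-1 * x) by field.
rewrite expRD mulrA ler_pM2r ?expR_gt0// expRN ler_pdivrMr ?expR_gt0//.
(* [exp (x / 2) >= (1 + x / 8)^4] dominates every quadratic polynomial. *)
have := expR_ge1Dx (8^-1 * x).
have -> : 2^-1 * x = 8^-1 * x + 8^-1 * x + (8^-1 * x + 8^-1 * x) by field.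
rewrite !expRD; set u := expR _; set t := 8^-1 * x => tu.
have t0 : 0 <= t by rewrite mulr_ge0.
have -> : x = 8 * t by rewrite /t; field.
apply: (@le_trans _ _ (16 * (a + b + c) * ((1 + t) ^+ 4))); last first.
  apply: ler_wpM2l; first by do ?[apply: addr_ge0|apply: mulr_ge0].
  have -> : u * u * (u * u) = u ^+ 4 by ring.
  by rewrite lerXn2r// nnegrE; [rewrite addr_ge0|exact: expR_ge0].
rewrite -subr_ge0.
(* The factor 16 is large enough for the difference, written in [t = x / 8], to have only
   nonnegative coefficients. *)
have -> : 16 * (a + b + c) * (1 + t) ^+ 4 -
    (a * (8 * t) ^+ 2 + (b + 2 * a) * (8 * t) + (b + 2 * a + c)) =
  a * (14 + 48 * t + 32 * t ^+ 2 + 64 * t ^+ 3 + 16 * t ^+ 4) +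
  b * (15 + 56 * t + 96 * t ^+ 2 + 64 * t ^+ 3 + 16 * t ^+ 4) +
  c * (15 + 64 * t + 96 * t ^+ 2 + 64 * t ^+ 3 + 16 * t ^+ 4) by ring.
by do ?[apply: addr_ge0|apply: mulr_ge0|apply: exprn_ge0|exact: expR_ge0].
Unshelve. all: by end_near. Qed.

Lemma integral_quadexp a b c x0 : 0 <= a -> 0 <= b -> 0 <= c -> 0 <= x0 ->
  (\int[mu]_(x in `[x0, +oo[) ((a * x ^+ 2 + b * x + c) * expR (- x))%:E
   = (quadexp a b c x0)%:E)%E.
Proof.
move=> a0 b0 c0 x00.
rewrite (@ge0_continuous_FTC2y _ _ (fun x => - quadexp a b c x) _ 0)//.
- by rewrite EFinN oppeK add0e.
- move=> x xx0; rewrite mulr_ge0 ?expR_ge0// !addr_ge0// mulr_ge0//.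
    by rewrite sqr_ge0.
  exact: le_trans xx0.
- by apply: continuous_subspaceT; exact: continuous_quadexp.
- exact: cvg_quadexp.
- apply/cvg_at_right_filter.
  have cF : continuous (fun x => - quadexp a b c x).
    move=> x; apply: differentiable_continuous; apply/derivable1_diffP.
    by have [] := is_derive_quadexp a b c x.
  exact: cF.
- move=> x _; rewrite derive1E.
  by have [_ ->] := is_derive_quadexp a b c x.
Qed.

End quadratic_exponential.

(** * Independence and the weak law for sums of logarithms *)

Section independence.
Context {d : measure_display} {T : measurableType d} {R : realType}.
Variable P : probability T R.
Local Open Scope ereal_scope.

(** The restriction of [P] to [B] has density [\1_B] with respect to [P]. *)
Lemma ge0_integral_mrestr (B : set T) (mB : measurable B) (f : T -> \bar R) :
  measurable_fun setT f -> (forall x, 0 <= f x) ->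
  \int[mrestr P mB]_x f x = \int[P]_(x in B) f x.
Proof.
move=> mf f0; rewrite (@ge0_integral_density _ _ _ _ P (\1_B))//.
- rewrite [RHS]integral_mkcond; apply: eq_integral => x _.
  by rewrite patchE indicE; case: ifPn => _; rewrite ?mule1 ?mule0.
- by move=> A mA; rewrite integral_indic// setIC.
Qed.

(** The hypothesis says that the law of [(X, Y)] under [P] restricted to [B] agrees on rectangles
    with [P B] times the product of the marginal laws. Uniqueness of product measures extends this
    to all measurable sets, and Tonelli's theorem splits the integral. *)
Lemma ge0_integral_independent (B : set T) (X Y : {RV P >-> R})
    (f g : R -> \bar R) :
  measurable B ->
  (forall E F, measurable E -> measurable F ->
    P (B `&` (X @^-1` E `&` Y @^-1` F)) =
    P B * (P (X @^-1` E) * P (Y @^-1` F))) ->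
  measurable_fun setT f -> (forall x, 0 <= f x) ->
  measurable_fun setT g -> (forall x, 0 <= g x) ->
  \int[P]_(w in B) (f (X w) * g (Y w)) =
  P B * (\int[P]_w f (X w) * \int[P]_w g (Y w)).
Proof.
move=> mB indep mf f0 mg g0.
have mXY : measurable_fun setT (fun w => (X w, Y w)).
  exact: measurable_fun_pair.
pose h (z : R * R) := f z.1 * g z.2.
have mh : measurable_fun setT h.
  by apply: emeasurable_funM; exact: measurableT_comp.
have h0 z : 0 <= h z by rewrite mule_ge0.
have PB0 : (0 <= fine (P B))%R by rewrite fine_ge0.
(* The factor [P B] is absorbed into the first marginal, so that the target is again a product of
   two measures. *)
pose m1 := mscale (NngNum PB0) (distribution P X).
have fX : \int[distribution P X]_x f x = \int[P]_w f (X w).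
  exact: ge0_integral_distribution.
have gY : \int[distribution P Y]_y g y = \int[P]_w g (Y w).
  exact: ge0_integral_distribution.
transitivity (\int[pushforward (mrestr P mB) (fun w => (X w, Y w))]_z h z).
  rewrite ge0_integral_pushforward// preimage_setT ge0_integral_mrestr//.
    exact: measurableT_comp.
  by move=> x; exact: h0.
transitivity (\int[m1 \x distribution P Y]_z h z).
  apply: eq_measure_integral.
  move=> A mA _; apply/esym; apply: product_measure_unique => //.
  move=> E F mE mF.
  rewrite [RHS](_ : _ = (fine (P B))%:E * P (X @^-1` E) * P (Y @^-1` F))//.
  by rewrite fineK ?fin_num_measure// -muleA -indep// setIC.
rewrite fubini_tonelli1// /fubini_F.
transitivity (\int[m1]_x (f x * \int[distribution P Y]_y g y)).
  by apply: eq_integral => x _; rewrite -ge0_integralZl.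
rewrite ge0_integralZr//; last by rewrite integral_ge0.
by rewrite ge0_integral_mscale//= fineK ?fin_num_measure// fX gY muleA.
Qed.

End independence.

(** The upper bound [ln (1 + y) <= y] at [y = - x / (1 + x)] gives [ln (1 + x) >= x / (1 + x)],
    which exceeds [x - x ^+ 2] by [x ^+ 3 / (1 + x)]. *)
Lemma ln1Dx_ge {R : realType} (x : R) : 0 <= x -> x - x ^+ 2 <= ln (1 + x).
Proof.
move=> x0; have x1 : 0 < 1 + x by rewrite ltr_wpDr.
have -> : ln (1 + x) = - ln (1 + - (x / (1 + x))).
  have -> : 1 + - (x / (1 + x)) = (1 + x)^-1 by field; rewrite lt0r_neq0.
  by rewrite lnV ?posrE// opprK.
rewrite lerNr; apply: le_trans (le_ln1Dx _) _.
  by rewrite ltrN2 ltr_pdivrMr// mul1r ltrDr.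
rewrite opprB lerNl opprB lerBlDr -subr_ge0.
have -> : x / (1 + x) + x ^+ 2 - x = x ^+ 3 / (1 + x).
  by field; rewrite lt0r_neq0.
by rewrite divr_ge0 ?exprn_ge0// ltW.
Qed.

Section Rintegral_lemmas.
Context {d : measure_display} {T : measurableType d} {R : realType}.
Variables (mu : {measure set T -> \bar R}) (D : set T) (mD : measurable D).

Lemma ge0_integral_EFinP (f : T -> R) (r : R) :
  measurable_fun D f -> (forall x, 0 <= f x) ->
  (\int[mu]_(x in D) (f x)%:E = r%:E)%E ->
  mu.-integrable D (EFin \o f) /\ \int[mu]_(x in D) f x = r.
Proof.
move=> mf f0 fr; split; last by rewrite /Rintegral fr.
apply/integrableP; split; first exact/measurable_EFinP.
under eq_integral do rewrite /= ger0_norm//.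
by rewrite fr ltry.
Qed.

Lemma integrable_sum_EFin (I : Type) (s : seq I) (F : I -> T -> R) :
  (forall i, mu.-integrable D (EFin \o F i)) ->
  mu.-integrable D (EFin \o (fun x => \sum_(i <- s) F i x)).
Proof.
move=> iF; rewrite (_ : _ \o _ = fun x => \sum_(i <- s) (EFin \o F i) x)%E.
  exact: integrable_sum.
by apply/funext => x /=; rewrite sumEFin.
Qed.

Lemma Rintegral_sum (I : Type) (s : seq I) (F : I -> T -> R) :
  (forall i, mu.-integrable D (EFin \o F i)) ->
  \int[mu]_(x in D) (\sum_(i <- s) F i x) =
  \sum_(i <- s) \int[mu]_(x in D) F i x.
Proof.
move=> iF; elim: s => [|i s IH].
  rewrite big_nil; under eq_Rintegral do rewrite big_nil.
  by rewrite /Rintegral integral0.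
rewrite big_cons -IH -RintegralD//; last exact: integrable_sum_EFin.
by apply: eq_Rintegral => x _; rewrite big_cons.
Qed.

End Rintegral_lemmas.

Lemma measurable_gt_fun {d} {T : measurableType d} {R : realType}
    (f : T -> R) (e : R) :
  measurable_fun setT f -> measurable [set w | e < f w].
Proof.
move=> mf; rewrite [X in measurable X](_ : _ = setT `&` f @^-1` `]e, +oo[).
  exact: mf.
by rewrite setTI; apply/seteqP; split => w /=; rewrite in_itv/= andbT.
Qed.

Lemma measurable_sum_ln {d} {T : measurableType d} {R : realType}
    (A : nat -> {mfun T >-> R}) (c : R) n :
  measurable_fun setT (fun w => \sum_(i < n) ln (1 + c * A i w)).
Proof.
apply: measurable_sum => i; apply: measurableT_comp => //.
by apply: measurable_funD => //; exact: measurable_funM.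
Qed.

(** * Deviation bound, on an event [B], for sums of logarithms of nonnegative variables *)

Section weak_law.
Context {d : measure_display} {T : measurableType d} {R : realType}.
Variables (P : probability T R) (X : nat -> {RV P >-> R}) (m s : R).
Hypothesis X0 : forall i w, 0 <= X i w.
Hypothesis Xm : forall i, (\int[P]_w (X i w)%:E = m%:E)%E.
Hypothesis Xs : forall i, (\int[P]_w ((X i w) ^+ 2)%:E = s%:E)%E.
Variable B : set T.
Hypothesis mB : measurable B.
Hypothesis indep : forall i j E F, i != j -> measurable E -> measurable F ->
  P (B `&` (X i @^-1` E `&` X j @^-1` F)) =
  (P B * (P (X i @^-1` E) * P (X j @^-1` F)))%E.

Let b := fine (P B).

Let PB : P B = b%:E. Proof. by rewrite fineK ?fin_num_measure. Qed.

(** [f] and [g] are nonnegative only on the half-line where the [X i] take their values; passing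
    through absolute values makes the integrands nonnegative everywhere, as
    [ge0_integral_independent] demands. *)
Let int_indep i j (f g : R -> R) : i != j ->
  measurable_fun setT f -> (forall x, 0 <= x -> 0 <= f x) ->
  measurable_fun setT g -> (forall x, 0 <= x -> 0 <= g x) ->
  (\int[P]_(w in B) (f (X i w) * g (X j w))%:E =
   b%:E * (\int[P]_w (f (X i w))%:E * \int[P]_w (g (X j w))%:E))%E.
Proof.
move=> ij mf f0 mg g0.
have := @ge0_integral_independent _ _ _ P B (X i) (X j)
  (fun x => `|f x|%:E) (fun x => `|g x|%:E) mB.
have E k (h : R -> R) : (forall x, 0 <= x -> 0 <= h x) ->
    forall w, `|h (X k w)| = h (X k w).
  by move=> h0 w; rewrite ger0_norm// h0.
under eq_integral do rewrite !E//.
under [X in (_ * (X * _))%E]eq_integral do rewrite E//.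
under [X in (_ * (_ * X))%E]eq_integral do rewrite E//.
rewrite -PB; apply => //.
- by move=> *; exact: indep.
- by apply/measurable_EFinP; exact: measurableT_comp.
- by apply/measurable_EFinP; exact: measurableT_comp.
Qed.

Let int1 : (\int[P]_w (1 : R)%:E = 1)%E.
Proof. by rewrite integral_cst// mul1e; exact: probability_setT. Qed.

Let iX i : P.-integrable B (EFin \o X i) /\ \int[P]_(w in B) X i w = b * m.
Proof.
apply: ge0_integral_EFinP => //; first exact: measurable_funTS.
(* A single moment is a product moment whose second function is the constant 1; [i.+1] supplies an
   index distinct from [i]. *)
have := @int_indep i i.+1 id (cst 1).
rewrite /= int1 Xm mule1 EFinM => <-//.
- by under [RHS]eq_integral do rewrite mulr1.
- by rewrite neq_ltn ltnSn.
Qed.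

Let iX2 i : P.-integrable B (EFin \o (fun w => (X i w) ^+ 2)) /\
  \int[P]_(w in B) (X i w) ^+ 2 = b * s.
Proof.
apply: ge0_integral_EFinP => //.
- by apply: measurable_funX; exact: measurable_funTS.
- by move=> ?; exact: sqr_ge0.
- have := @int_indep i i.+1 (fun x => x ^+ 2) (cst 1).
  rewrite /= int1 Xs mule1 EFinM => <-//.
  + by under [RHS]eq_integral do rewrite mulr1.
  + by rewrite neq_ltn ltnSn.
  + by move=> ? _; exact: sqr_ge0.
Qed.

Let iXX i j : i != j ->
  P.-integrable B (EFin \o (fun w => X i w * X j w)) /\
  \int[P]_(w in B) (X i w * X j w) = b * (m * m).
Proof.
move=> ij; apply: ge0_integral_EFinP => //.
- by apply: measurable_funM; exact: measurable_funTS.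
- by move=> ?; rewrite mulr_ge0.
- by have := @int_indep i j id id; rewrite /= !Xm -!EFinM; exact.
Qed.

Let icst (r : R) : P.-integrable B (EFin \o cst r) /\
  \int[P]_(w in B) r = b * r.
Proof.
split; first exact: finite_measure_integrable_cst.
by rewrite Rintegral_cst// mulrC.
Qed.

Let icov i j : 
  P.-integrable B (EFin \o (fun w => (X i w - m) * (X j w - m))) /\
  \int[P]_(w in B) ((X i w - m) * (X j w - m)) =
  b * (if i == j then s - m ^+ 2 else 0).
Proof.
have [i1 e1] : P.-integrable B (EFin \o (fun w => X i w * X j w)) /\
    \int[P]_(w in B) (X i w * X j w) = b * (if i == j then s else m * m).
  by case: eqVneq => [->|ij]; [exact: iX2|exact: iXX].
have [iXi eXi] := iX i; have [iXj eXj] := iX j; have [ic ec] := icst (m * m).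
have iXij : P.-integrable B (EFin \o (fun w => X i w + X j w)).
  exact: integrableD iXi iXj.
have imX : P.-integrable B (EFin \o (fun w => m * (X i w + X j w))).
  exact: integrableZl iXij.
have i2 : P.-integrable B
    (EFin \o (fun w => X i w * X j w - m * (X i w + X j w))).
  exact: integrableB i1 imX.
have e w : (X i w - m) * (X j w - m) =
    X i w * X j w - m * (X i w + X j w) + m * m by ring.
split.
  rewrite (_ : _ \o _ =
    EFin \o (fun w => X i w * X j w - m * (X i w + X j w) + m * m)).
    exact: integrableD i2 ic.
  by apply/funext => w /=; rewrite e.
under eq_Rintegral do rewrite e.
rewrite RintegralD// RintegralB// RintegralZl// RintegralD// e1 eXi eXj ec.
by case: eqP => _; ring.
Qed.

Let S n w := \sum_(i < n) (X i w - m).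

(** The square expands into a double sum of covariances; the off-diagonal ones vanish by [icov],
    leaving [n] variances. *)
Let iS n : P.-integrable B (EFin \o (fun w => S n w ^+ 2)) /\
  \int[P]_(w in B) (S n w ^+ 2) = b * (n%:R * (s - m ^+ 2)).
Proof.
have SE w : S n w ^+ 2 = \sum_(i < n) \sum_(j < n) (X i w - m) * (X j w - m).
  by rewrite expr2 big_distrlr.
split.
  rewrite (_ : _ \o _ = EFin \o
      (fun w => \sum_(i < n) \sum_(j < n) (X i w - m) * (X j w - m))).
    by do 2 apply: integrable_sum_EFin => // ?; exact: (icov _ _).1.
  by apply/funext => w /=; rewrite SE.
under eq_Rintegral do rewrite SE.
rewrite Rintegral_sum//; last first.
  by move=> i; apply: integrable_sum_EFin => // j; exact: (icov _ _).1.
under eq_bigr => i _.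
  rewrite Rintegral_sum//; last by move=> j; exact: (icov _ _).1.
  under eq_bigr => j _ do rewrite (icov _ _).2.
  rewrite -mulr_sumr (bigD1 i)//= eqxx big1 ?addr0; last first.
    by move=> j ji; rewrite ifF//; apply/negbTE; rewrite eq_sym.
  over.
by rewrite -mulr_sumr sumr_const card_ord mulr_natl.
Qed.

Let U n w := \sum_(i < n) X i w ^+ 2.

Let iU n : P.-integrable B (EFin \o U n) /\
  \int[P]_(w in B) U n w = b * (n%:R * s).
Proof.
split; first by apply: integrable_sum_EFin => // ?; exact: (iX2 _).1.
rewrite Rintegral_sum//; last by move=> i; exact: (iX2 _).1.
under eq_bigr => i _ do rewrite (iX2 _).2.
by rewrite sumr_const card_ord -mulr_natl; ring.
Qed.

Let sumln c n w := \sum_(i < n) ln (1 + c / n%:R * X i w).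

(** With [k = c / n], the sum of logarithms lies between [k] times the sum of the [X i] minus
    [k ^+ 2 * U n w] and that linear term itself, whose distance to [c * m] is the absolute value of
    [k * S n w]. *)
Lemma sum_ln_dev c n w : 0 <= c -> (0 < n)%N ->
  `|sumln c n w - c * m| <= `|c / n%:R * S n w| + (c / n%:R) ^+ 2 * U n w.
Proof.
move=> c0 n0; have n0' : n%:R != 0 :> R by rewrite pnatr_eq0 -lt0n.
set k := c / n%:R; have k0 : 0 <= k by rewrite divr_ge0.
have kX i : 0 <= k * X i w by rewrite mulr_ge0.
have -> : k * S n w = k * (\sum_(i < n) X i w) - c * m.
  by rewrite /S sumrB sumr_const card_ord mulrBr -mulr_natr /k; field.
have up : sumln c n w <= k * (\sum_(i < n) X i w).
  rewrite mulr_sumr; apply: ler_sum => i _; apply: le_ln1Dx.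
  by rewrite (lt_le_trans _ (kX i)).
have lo : k * (\sum_(i < n) X i w) - k ^+ 2 * U n w <= sumln c n w.
  rewrite !mulr_sumr -sumrB; apply: ler_sum => i _.
  by rewrite -exprMn; exact: ln1Dx_ge.
have U0 : 0 <= k ^+ 2 * U n w.
  by rewrite mulr_ge0 ?sqr_ge0// sumr_ge0// => i _; exact: sqr_ge0.
rewrite ler_norml; apply/andP; split.
  by have := ler_norm (- (k * \sum_(i < n) X i w - c * m)); rewrite normrN; lra.
by have := ler_norm (k * \sum_(i < n) X i w - c * m); lra.
Qed.

Let s0 : 0 <= s.
Proof.
by rewrite -lee_fin -(Xs 0) integral_ge0// => w _; rewrite lee_fin sqr_ge0.
Qed.

(** The indicator of the deviation is at most [G], a squared linear error plus a quadratic error,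
    each scaled by [e / 2]; integrating [G] over [B] combines the inequalities of Chebyshev and
    Markov. *)
Lemma sum_ln_tail c e n : 0 <= c -> 0 < e -> (0 < n)%N ->
  (P (B `&` [set w | (e < `|sumln c n w - c * m|)%R]) <=
   (b * ((4 * c ^+ 2 / e ^+ 2 + 2 * c ^+ 2 / e) * s / n%:R))%:E)%E.
Proof.
move=> c0 e0 n0; set V := [set w | _].
have n0' : 0 < n%:R :> R by rewrite ltr0n.
have mV : measurable V.
  apply: measurable_gt_fun; apply: measurableT_comp => //.
  by apply: measurable_funB => //; exact: measurable_sum_ln.
have e20 : 0 < e / 2 by rewrite divr_gt0.
set k := c / n%:R.
(* One of the two error terms of [sum_ln_dev] exceeds [e / 2] on [V]. *)
pose G w := (2 / e * k) ^+ 2 * S n w ^+ 2 + 2 / e * k ^+ 2 * U n w.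
have [iSn eSn] := iS n; have [iUn eUn] := iU n.
have i1 : P.-integrable B (EFin \o (fun w => (2 / e * k) ^+ 2 * S n w ^+ 2)).
  exact: integrableZl iSn.
have i2 : P.-integrable B (EFin \o (fun w => 2 / e * k ^+ 2 * U n w)).
  exact: integrableZl iUn.
have iG : P.-integrable B (EFin \o G) by exact: integrableD i1 i2.
have U0 w : 0 <= U n w by rewrite sumr_ge0// => i _; exact: sqr_ge0.
have G0 w : 0 <= G w.
  by rewrite addr_ge0// mulr_ge0 ?sqr_ge0// mulr_ge0 ?sqr_ge0// divr_ge0// ltW.
have GV w : V w -> 1 <= G w.
  rewrite /V /= => /lt_le_trans/(_ (sum_ln_dev w c0 n0)); rewrite -/k => h.
  have [h1|h1] := leP (e / 2) `|k * S n w|.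
    apply: ler_wpDr.
      by rewrite mulr_ge0 ?U0// mulr_ge0 ?sqr_ge0// divr_ge0// ltW.
    have -> : (2 / e * k) ^+ 2 * S n w ^+ 2 = (k * S n w / (e / 2)) ^+ 2.
      by field; rewrite lt0r_neq0.
    rewrite -real_normK ?num_real// exprn_ege1// normrM normfV (gtr0_norm e20).
    by rewrite ler_pdivlMr// mul1r.
  apply: ler_wpDl; first by rewrite mulr_ge0 ?sqr_ge0.
  have -> : 2 / e * k ^+ 2 * U n w = k ^+ 2 * U n w / (e / 2).
    by field; rewrite lt0r_neq0.
  by rewrite ler_pdivlMr// mul1r; lra.
have -> : P (B `&` V) = (\int[P]_(w in B) (\1_V w)%:E)%E.
  by rewrite integral_indic// setIC.
apply: (@le_trans _ _ (\int[P]_(w in B) (G w)%:E)%E).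
  apply: ge0_le_integral => //.
  - exact/measurable_EFinP/measurable_funTS/measurable_indic.
  - exact: measurable_int iG.
  - move=> w _; rewrite lee_fin indicE.
    by have [/set_mem/GV|] := boolP (w \in V).
rewrite -[leLHS]fineK; last exact: integrable_fin_num.
rewrite lee_fin -/(Rintegral _ _ _) RintegralD// !RintegralZl// eSn eUn.
have b0 : 0 <= b by rewrite fine_ge0.
rewrite -subr_ge0.
(* The stated bound uses [s] where the computation yields the variance [s - m ^+ 2]; the gap is this
   nonnegative term. *)
rewrite [leRHS](_ : _ = b * (4 * c ^+ 2 / e ^+ 2 * m ^+ 2 / n%:R)); last first.
  by rewrite /k; field; rewrite !lt0r_neq0.
rewrite mulr_ge0// mulr_ge0 ?invr_ge0 ?(ltW n0')// mulr_ge0 ?sqr_ge0//.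
by rewrite divr_ge0 ?sqr_ge0// mulr_ge0 ?sqr_ge0.
Qed.

(** The denominator [n.+1] covers the empty sum and matches the binomial average taken later. For
    [n = 0] the constant is at least 1 and the bound is trivial; for [n > 0],
    [1 / n <= 2 / (n + 1)]. *)
Lemma sum_ln_tailS c e n : 0 <= c -> 0 < e ->
  (P (B `&` [set w | (e < `|sumln c n w - c * m|)%R]) <=
   P B * ((1 + 2 * ((4 * c ^+ 2 / e ^+ 2 + 2 * c ^+ 2 / e) * s)) /
          n.+1%:R)%:E)%E.
Proof.
move=> c0 e0; set D := (_ + _) * s.
have D0 : 0 <= D.
  rewrite mulr_ge0// addr_ge0// mulr_ge0 ?invr_ge0 ?sqr_ge0 ?(ltW e0)//;
  by rewrite mulr_ge0 ?sqr_ge0.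
have [->|n0] := posnP n.
  rewrite divr1 (@le_trans _ _ (P B))//.
    rewrite le_measure ?inE//; apply: measurableI => //.
    apply: measurable_gt_fun; apply: measurableT_comp => //.
    by apply: measurable_funB => //; exact: measurable_sum_ln.
  by rewrite PB -EFinM lee_fin ler_peMr ?fine_ge0// lerDl mulr_ge0.
apply: le_trans (sum_ln_tail c0 e0 n0) _.
rewrite PB -EFinM lee_fin ler_wpM2l ?fine_ge0// -/D.
have n1 : 1 <= n%:R :> R by rewrite ler1n.
rewrite ler_pdivrMr ?(lt_le_trans _ n1)// mulrAC ler_pdivlMr ?ltr0n//.
rewrite -natr1 mulrDl mulrDr; nra.
Qed.

End weak_law.

(** * Binomial averages *)

Section binomial_sums.
Context {R : realType}.
Implicit Type p : R.

(** After multiplication by [n.+1%:R * p], the summand of index [k] becomes the term of index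
    [k + 1] in the expansion of [((1 - p) + p) ^+ n.+1 = 1]; dropping the term of index 0 gives the
    inequality. *)
Lemma sum_binomial_pmf_div n p : 0 < p <= 1 ->
  \sum_(k < n.+1) binomial_pmf n p k / k.+1%:R <= (n.+1%:R * p)^-1.
Proof.
move=> /andP[p0 p1]; have np0 : 0 < n.+1%:R * p by rewrite mulr_gt0.
rewrite -[leRHS]mul1r ler_pdivlMr// mulr_suml.
have s1 : ((1 - p) + p) ^+ n.+1 = 1 by rewrite subrK expr1n.
rewrite -[leRHS]s1 exprDn [leRHS]big_ord_recl ler_wpDl//.
  by rewrite mulrn_wge0// mulr_ge0 ?exprn_ge0 ?subr_ge0// ltW.
apply: ler_sum => k _; rewrite le_eqVlt; apply/orP; left; apply/eqP.
rewrite lift0 /binomial_pmf /= subSS exprS -[in LHS]mulr_natr -[RHS]mulr_natr.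
have k0 : k.+1%:R != 0 :> R by rewrite pnatr_eq0.
apply: (mulIf k0); rewrite -[RHS]mulrA -natrM [('C(_, _) * _)%N]mulnC.
by rewrite -mul_bin_diag natrM /=; field; rewrite nat1r.
Qed.

Lemma binomial_pmf_sub n p k : (k <= n)%N ->
  binomial_pmf n p (n - k) = binomial_pmf n (1 - p) k.
Proof.
move=> kn; rewrite /binomial_pmf /unstable.onem.
have -> : 1 - (1 - p) = p by ring.
by rewrite subKn// bin_sub// mulrC.
Qed.

(** Reversing the summation order exchanges successes and failures, hence [p] and [1 - p]. *)
Lemma sum_binomial_pmf_div_sub n p : 0 <= p < 1 ->
  \sum_(k < n.+1) binomial_pmf n p k / (n - k).+1%:R <= (n.+1%:R * (1 - p))^-1.
Proof.
move=> /andP[p0 p1].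
apply: le_trans (_ : \sum_(k < n.+1) binomial_pmf n (1 - p) k / k.+1%:R <= _).
  rewrite (reindex_inj rev_ord_inj)/=; apply: ler_sum => k _.
  have kn : (k <= n)%N by rewrite -ltnS.
  by rewrite subSS subKn// binomial_pmf_sub.
by apply: sum_binomial_pmf_div; rewrite subr_gt0 p1/= lerBlDr lerDl.
Qed.

Lemma binomial_prob_set1 n p k : 0 <= p <= 1 ->
  binomial_prob n p [set k] = (binomial_pmf n p k)%:E.
Proof.
by move=> p01; rewrite /binomial_prob p01 esum_set1// lee_fin binomial_pmf_ge0.
Qed.

Lemma binomial_prob_gt n p : 0 <= p <= 1 ->
  binomial_prob n p [set k | (n < k)%N] = 0%E.
Proof.
move=> p01; rewrite /binomial_prob p01 esum1// => k /= nk.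
by rewrite /binomial_pmf bin_small.
Qed.

End binomial_sums.

Lemma mutually_independent3 {d} {T : measurableType d} {R : realType}
    (P : probability T R) {I : choiceType} (F : I -> set_system T) (a b c : I)
    (A B C : set T) :
  mutually_independent P F -> a != b -> a != c -> b != c ->
  F a A -> F b B -> F c C ->
  P (A `&` (B `&` C)) = (P A * (P B * P C))%E.
Proof.
move=> indep ab ac bc FA FB FC.
(* The family must be total on [I]; only its values at [a], [b] and [c] enter the intersection. *)
pose E i := if i == a then A else if i == b then B else C.
have Ea : E a = A by rewrite /E eqxx.
have Eb : E b = B by rewrite /E eq_sym (negbTE ab) eqxx.
have Ec : E c = C by rewrite /E eq_sym (negbTE ac) eq_sym (negbTE bc).
have := indep (a |` (b |` [fset c]))%fset E.
rewrite (_ : \bigcap_(i in _) E i = A `&` (B `&` C)); last first.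
  rewrite -Ea -Eb -Ec; apply/seteqP; split => w.
    by move=> h; do ?split; apply: h; rewrite /= !inE eqxx ?orbT.
  by move=> [wa [wb wc]] i /=; rewrite !inE => /orP[|/orP[]] /eqP ->.
move=> ->.
  by rewrite !big_fsetU1 ?inE ?negb_or ?ab//= big_seq_fset1 Ea Eb Ec.
move=> i; rewrite !inE => /orP[|/orP[]] /eqP ->.
- by rewrite Ea.
- by rewrite Eb.
- by rewrite Ec.
Qed.

(** * Moments of the channel gains *)

Section conditional_exponential.
Context {R : realType}.
Notation mu := (@lebesgue_measure R).

Let measurable_quadE (a b c : R) (D : set R) :
  measurable_fun D (fun x : R => ((a * x ^+ 2 + b * x + c) * expR (- x))%:E).
Proof.
apply/measurable_funTS/measurable_EFinP; apply: continuous_measurable_fun.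
move=> x; exact: continuous_quadexp.
Qed.

Lemma integral_quadexp_oy (a b c x0 : R) :
  0 <= a -> 0 <= b -> 0 <= c -> 0 <= x0 ->
  (\int[mu]_(x in `]x0, +oo[) ((a * x ^+ 2 + b * x + c) * expR (- x))%:E
   = (quadexp a b c x0)%:E)%E.
Proof.
by move=> a0 b0 c0 x00; rewrite integral_itv_obnd_cbnd// integral_quadexp.
Qed.

(** The integral over the whole half-line minus its finite tail beyond [x0]. *)
Lemma integral_quadexp_0c (a b c x0 : R) :
  0 <= a -> 0 <= b -> 0 <= c -> 0 <= x0 ->
  (\int[mu]_(x in `[0%R, x0]) ((a * x ^+ 2 + b * x + c) * expR (- x))%:E
   = (quadexp a b c 0 - quadexp a b c x0)%:E)%E.
Proof.
move=> a0 b0 c0 x00; have := @integral_quadexp R a b c 0 a0 b0 c0 (lexx _).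
have -> : `[0, +oo[%classic = `[0, x0]%classic `|` `]x0, +oo[%classic :> set R.
  by rewrite -itv_bndbnd_setU// bnd_simp.
rewrite ge0_integral_setU//=.
- by rewrite integral_quadexp_oy// EFinB => <-; rewrite addeK.
- exact: measurable_quadE.
- move=> x xU; have x_ge0 : 0 <= x.
    by case: xU; rewrite /= in_itv/= => /andP[]// /ltW /(le_trans x00).
  rewrite lee_fin mulr_ge0 ?expR_ge0// addr_ge0// addr_ge0// mulr_ge0//.
  exact: sqr_ge0.
- apply/disj_setPLR => x/=; rewrite !in_itv/= => /andP[_ xx0] /andP[]//.
  by rewrite ltNge xx0.
Qed.

Context {d : measure_display} {T : measurableType d}.
Variables (P : probability T R).

Lemma ge0_expectation_density (A : {RV P >-> R}) (f h : R -> R) :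
  has_density A f -> measurable_fun setT f -> (forall x, 0 <= f x) ->
  measurable_fun setT h -> (forall x, 0 <= h x) ->
  (\int[P]_w (h (A w))%:E = \int[mu]_x (h x * f x)%:E)%E.
Proof.
move=> Af mf f0 mh h0.
(* The Borel structures of [R] and [measurableTypeR R] carry different
   displays; only the latter is the domain of [lebesgue_measure]. *)
pose A' : T -> measurableTypeR R := A.
have mA' : measurable_fun setT A' by exact: (@measurable_funP _ _ _ _ _ A).
have mhE : measurable_fun setT (EFin \o h) by exact/measurable_EFinP.
transitivity (\int[pushforward P A']_x (h x)%:E)%E.
  by rewrite ge0_integral_pushforward//= => x _; rewrite lee_fin.
rewrite (@ge0_integral_density _ _ _ _ mu f)//.
Qed.

Lemma has_density_restrict_lt0 (A : {RV P >-> R}) (f : R -> R) (D : set R) :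
  has_density A (f \_ D) -> D `<=` [set x | 0 <= x] ->
  P [set w | A w < 0] = 0%E.
Proof.
move=> Af D0.
have -> : [set w | A w < 0] = A @^-1` `]-oo, 0[.
  by apply/seteqP; split => w /=; rewrite in_itv.
rewrite -[LHS]/(distribution P A _) Af// integral0_eq// => x /=.
rewrite in_itv/= => x0; rewrite patchE memNset// => /D0/=.
by rewrite leNgt x0.
Qed.

(** Treats both gain laws and both moments at once. The density only makes [A] nonnegative almost
    surely, hence the truncation at 0, which is the identity on [D]. *)
Lemma ge0_expectation_exp_restrict (A : {RV P >-> R}) (D : set R) (q a b : R) :
  measurable D -> D `<=` [set x | 0 <= x] -> 0 < q -> 0 <= a -> 0 <= b ->
  has_density A ((fun x => expR (- x) / q) \_ D) ->
  (\int[P]_w (a * (Num.max (A w) 0) ^+ 2 + b * Num.max (A w) 0)%:E =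
   q^-1%:E *
   \int[mu]_(x in D) ((a * x ^+ 2 + b * x + 0) * expR (- x))%:E)%E.
Proof.
move=> mD D0 q0 a0 b0 Af.
have mmax : measurable_fun setT (fun x : R => Num.max x 0).
  exact: measurable_maxr.
rewrite (@ge0_expectation_density A _
  (fun x => a * (Num.max x 0) ^+ 2 + b * Num.max x 0) Af).
- rewrite -ge0_integralZl//=.
  + rewrite [RHS]integral_mkcond; apply: eq_integral => x _; rewrite !patchE.
    case: ifPn => [xD|_]; last by rewrite mulr0.
    have x0 : 0 <= x := D0 _ (set_mem xD).
    by rewrite max_l// -EFinM; congr EFin; ring.
  + exact: measurable_quadE.
  + move=> x xD; have x0 : 0 <= x := D0 _ xD.
    by rewrite lee_fin mulr_ge0 ?expR_ge0// addr0 addr_ge0 ?mulr_ge0 ?sqr_ge0.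
  + by rewrite lee_fin invr_ge0 ltW.
- apply/(measurable_restrictT _ _).1 => //; apply: measurable_funTS.
  apply: measurable_funM => //; apply: measurableT_comp => //.
- move=> x; rewrite patchE; case: ifPn => // _.
  by rewrite divr_ge0 ?expR_ge0// ltW.
- apply: measurable_funD; apply: measurable_funM => //.
  exact: measurable_funX.
- by move=> x; rewrite addr_ge0// mulr_ge0 ?sqr_ge0// le_max lexx orbT.
Qed.

End conditional_exponential.

(** * Deviation bound for variables that are nonnegative only almost surely *)

Section weak_law_ae_ge0.
Context {d : measure_display} {T : measurableType d} {R : realType}.
Variables (P : probability T R) (A : nat -> {RV P >-> R}) (m s : R).
Hypothesis A0 : forall i, P [set w | A i w < 0] = 0%E.
Hypothesis Am : forall i, (\int[P]_w (Num.max (A i w) 0)%:E = m%:E)%E.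
Hypothesis As : forall i, (\int[P]_w (Num.max (A i w) 0 ^+ 2)%:E = s%:E)%E.

(** The constant [C] is chosen before [B] and [n], so that one constant serves every value of the
    channel count. [sum_ln_tailS] is applied to the positive parts of the [A i], which differ from
    the [A i] only on a null set. *)
Lemma ae_ge0_sum_ln_tail (c e : R) : 0 <= c -> 0 < e ->
  exists2 C : R, 0 <= C & forall B n,
    measurable B ->
    (forall i j E F, i != j -> measurable E -> measurable F ->
      P (B `&` (A i @^-1` E `&` A j @^-1` F)) =
      (P B * (P (A i @^-1` E) * P (A j @^-1` F)))%E) ->
    (P (B `&` [set w | (e < `|\sum_(i < n) ln (1 + c / n%:R * A i w)
                              - c * m|)%R]) <= P B * (C / n.+1%:R)%:E)%E.
Proof.
move=> c0 e0.
have s0 : 0 <= s.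
  by rewrite -lee_fin -(As 0) integral_ge0// => w _; rewrite lee_fin sqr_ge0.
exists (1 + 2 * ((4 * c ^+ 2 / e ^+ 2 + 2 * c ^+ 2 / e) * s)).
  by do ?[apply: addr_ge0|apply: mulr_ge0|apply: exprn_ge0|rewrite invr_ge0|
    exact: ltW].
move=> B n mB indep.
pose X i : {RV P >-> R} := (A i \max cst 0)%R.
have X0 i w : 0 <= X i w by rewrite /X/= le_max lexx orbT.
have mmax : measurable_fun setT (fun x : R => Num.max x 0).
  exact: measurable_maxr.
have mpre E : measurable E -> measurable ((fun x : R => Num.max x 0) @^-1` E).
  by move=> mE; rewrite -[X in measurable X]setTI; exact: mmax.
(* Events of the truncated variable are events of the original one, through the preimage under the
   truncation. *)
have indepX i j E F : i != j -> measurable E -> measurable F ->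
    P (B `&` (X i @^-1` E `&` X j @^-1` F)) =
    (P B * (P (X i @^-1` E) * P (X j @^-1` F)))%E.
  by move=> ij /mpre mE /mpre mF; exact: (indep i j _ _ ij mE mF).
have := sum_ln_tailS X0 Am As mB indepX n c0 e0.
apply: le_trans; pose N := \bigcup_i [set w | A i w < 0].
have mA0 i : measurable [set w | A i w < 0].
  rewrite (_ : [set w | _] = setT `&` A i @^-1` `]-oo, 0[).
    exact: measurable_funP.
  by rewrite setTI; apply/seteqP; split => w /=; rewrite in_itv.
have mN : measurable N by exact: bigcup_measurable.
have N0 : P N = 0%E.
  apply/(negligibleP _ mN); apply: negligible_bigcup => i.
  by apply/(negligibleP _ (mA0 i)); exact: A0.
have mV (Y : nat -> {RV P >-> R}) : measurable
    (B `&` [set w | e < `|\sum_(i < n) ln (1 + c / n%:R * Y i w) - c * m|]).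
  apply: measurableI => //; apply: measurable_gt_fun.
  apply: measurableT_comp => //.
  by apply: measurable_funB => //; exact: measurable_sum_ln.
rewrite -[leRHS](measureU0 (mV X) mN N0) le_measure ?inE//.
  exact: measurableU.
move=> w [Bw ew]; have [Nw|Nw] := pselect (N w); [by right|left; split => //].
move: ew; rewrite /=.
rewrite (eq_bigr (fun i : 'I_n => ln (1 + c / n%:R * X i w)))// => i _.
congr (ln (1 + _ * _)); rewrite /X/= max_l// leNgt; apply/negP => Ai.
by apply: Nw; exists i.
Qed.

End weak_law_ae_ge0.

Section gain_moments.
Context {R : realType} {d : measure_display} {T : measurableType d}.
Variables (P : probability T R) (tau : R).
Hypothesis tau0 : 0 < tau.

Lemma p0_gt0 : 0 < p0 tau.
Proof. by rewrite subr_gt0 expR_lt1 oppr_lt0. Qed.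

Lemma p1_gt0 : 0 < p1 tau. Proof. exact: expR_gt0. Qed.

(** The mean enters the limit of the rate, the second moment the constant of the deviation bound. *)
Lemma gain0_moments (A : {RV P >-> R}) : has_density A (density0 tau) ->
  [/\ P [set w | A w < 0] = 0%E,
      (\int[P]_w (Num.max (A w) 0)%:E = (1 - tau * p1 tau / p0 tau)%:E)%E &
      (\int[P]_w (Num.max (A w) 0 ^+ 2)%:E =
        ((quadexp 1 0 0 0 - quadexp 1 0 0 tau) / p0 tau)%:E)%E].
Proof.
move=> Ad; have D0 : `[0, tau] `<=` [set x : R | 0 <= x].
  by move=> x /=; rewrite in_itv/= => /andP[].
have M a b (a0 : 0 <= a) (b0 : 0 <= b) :=
  @ge0_expectation_exp_restrict _ _ _ P A _ _ a b (measurable_itv _) D0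
    p0_gt0 a0 b0 Ad.
split.
- exact: has_density_restrict_lt0 Ad D0.
- have := M 0 1 (lexx _) ler01; rewrite integral_quadexp_0c ?(ltW tau0)//.
  under eq_integral do rewrite mul0r add0r mul1r.
  move=> ->//; rewrite -EFinM; congr EFin.
  rewrite /quadexp oppr0 expR0 /p0 /p1; field.
  exact: (lt0r_neq0 p0_gt0).
- have := M 1 0 ler01 (lexx _); rewrite integral_quadexp_0c ?(ltW tau0)//.
  under eq_integral do rewrite mul0r addr0 mul1r.
  
  by move=> ->//; rewrite -EFinM mulrC.
Qed.

Lemma gain1_moments (A : {RV P >-> R}) : has_density A (density1 tau) ->
  [/\ P [set w | A w < 0] = 0%E,
      (\int[P]_w (Num.max (A w) 0)%:E = (tau + 1)%:E)%E &
      (\int[P]_w (Num.max (A w) 0 ^+ 2)%:E =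
        (quadexp 1 0 0 tau / p1 tau)%:E)%E].
Proof.
move=> Ad; have D0 : `]tau, +oo[ `<=` [set x : R | 0 <= x].
  by move=> x /=; rewrite in_itv/= andbT => /(lt_trans tau0)/ltW.
have M a b (a0 : 0 <= a) (b0 : 0 <= b) :=
  @ge0_expectation_exp_restrict _ _ _ P A _ _ a b (measurable_itv _) D0
    p1_gt0 a0 b0 Ad.
split.
- exact: has_density_restrict_lt0 Ad D0.
- have := M 0 1 (lexx _) ler01; rewrite integral_quadexp_oy ?(ltW tau0)//.
  under eq_integral do rewrite mul0r add0r mul1r.
  move=> ->//; rewrite -EFinM; congr EFin.
  rewrite /quadexp /p1; field.
  exact: (lt0r_neq0 p1_gt0).
- have := M 1 0 ler01 (lexx _); rewrite integral_quadexp_oy ?(ltW tau0)//.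
  under eq_integral do rewrite mul0r addr0 mul1r.
  by move=> ->//; rewrite -EFinM mulrC.
Qed.

End gain_moments.

(** * Convergence of the total rate *)

Section in_probability.
Context {d : measure_display} {T : measurableType d} {R : realType}.
Variable P : probability T R.

(** Handles sums with a random number of terms: the preimage is cut along the countably many values
    of [M]. *)
Lemma measurable_fun_nat_index (M : {RV P >-> nat}) (F : nat -> T -> R) :
  (forall n, measurable_fun setT (F n)) ->
  measurable_fun setT (fun w => F (M w) w).
Proof.
move=> mF _ Y mY; rewrite setTI.
have -> : (fun w => F (M w) w) @^-1` Y =
    \bigcup_n (M @^-1` [set n] `&` F n @^-1` Y).
  apply/seteqP; split => w /=; first by move=> Yw; exists (M w).
  by move=> [n _ [/= -> ]].
apply: bigcupT_measurable => n; apply: measurableI.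
  by rewrite -[X in measurable X]setTI; exact: measurable_funP.
by rewrite -[X in measurable X]setTI; exact: mF.
Qed.

(** If the limits differed, every [X n w] would be farther than a quarter of their distance from one
    of them, so the two deviation probabilities would sum to at least 1 for all [n]. *)
Lemma cvg_in_probability_unique (X : nat -> T -> R) (l l' : R) :
  (forall n, measurable_fun setT (X n)) ->
  cvg_in_probability P X l -> cvg_in_probability P X l' -> l = l'.
Proof.
move=> mX Xl Xl'; apply/eqP/negPn/negP => ll'.
have e0 : 0 < `|l - l'| / 2 by rewrite divr_gt0// normr_gt0 subr_eq0.
have mV n a : measurable [set w | `|l - l'| / 2 / 2 < `|X n w - a|].
  apply: measurable_gt_fun; apply: measurableT_comp => //.
  exact: measurable_funB.
have e20 : 0 < `|l - l'| / 2 / 2 by rewrite divr_gt0.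
have := cvgeD _ (Xl _ e20) (Xl' _ e20).
rewrite adde0 => /(_ _ isT) c.
suff : (1 <= 0 :> \bar R)%E by rewrite lee_fin ler10.
apply: (cvge_to_ge c); apply: nearW => n.
rewrite -(@probability_setT _ _ _ P).
apply: le_trans (measureU2 _ (mV n l) (mV n l')).
rewrite le_measure ?inE//; first exact: measurableU.
move=> w _ /=; apply/orP; rewrite -implyNb; apply/implyP; rewrite -leNgt => h.
have := ler_distD (X n w) l l'; rewrite (distrC l (X n w)).
lra.
Qed.

End in_probability.

Section total_rate.
Context {d : measure_display} {T : measurableType d} {R : realType}.
Variables (P : probability T R) (tau g0 : R).
Variables (N : nat -> {RV P >-> nat}) (A0 A1 : nat -> {RV P >-> R}).
Hypothesis tau0 : 0 < tau.
Hypothesis g01 : 0 <= g0 <= 1.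
Hypothesis Nbinom : forall (K : nat) (U : set nat),
  distribution P (N K) U = binomial_prob K (p0 tau) U.
Hypothesis A0density : forall i : nat, has_density (A0 i) (density0 tau).
Hypothesis A1density : forall j : nat, has_density (A1 j) (density1 tau).
Hypothesis indep :
  forall K : nat, mutually_independent P (protocol_events (N K) A0 A1).

Lemma measurable_total_rate rho K :
  measurable_fun setT (total_rate g0 N A0 A1 rho K).
Proof.
apply: (@measurable_fun_nat_index _ _ _ P (N K) (fun n w =>
  \sum_(i < n) ln (1 + g0 * rho / n%:R * A0 i w) +
  \sum_(j < (K - n)%N) ln (1 + (1 - g0) * rho / (K - n)%N%:R * A1 j w))).
by move=> n; apply: measurable_funD; exact: measurable_sum_ln.
Qed.

Let measurable_count K (U : set nat) : measurable (N K @^-1` U).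
Proof. by rewrite -[X in measurable X]setTI; exact: measurable_funP. Qed.

Let sigma_count K (U : set nat) : sigma_of (N K) (N K @^-1` U).
Proof. by exists U => //; rewrite setTI. Qed.

Let sigma_gain (A : {RV P >-> R}) E : measurable E -> sigma_of A (A @^-1` E).
Proof. by move=> mE; exists E => //; rewrite setTI. Qed.

Let p0_le1 : 0 < p0 tau < 1.
Proof. by rewrite p0_gt0//= ltrBlDr ltrDl expR_gt0. Qed.

Let P_count K k : P (N K @^-1` [set k]) = (binomial_pmf K (p0 tau) k)%:E.
Proof.
have /andP[q0 q1] := p0_le1.
by rewrite -binomial_prob_set1 ?(ltW q0) ?(ltW q1)// -Nbinom.
Qed.

Let indep0 K U i j E F : i != j -> measurable E -> measurable F ->
  P (N K @^-1` U `&` (A0 i @^-1` E `&` A0 j @^-1` F)) =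
  (P (N K @^-1` U) * (P (A0 i @^-1` E) * P (A0 j @^-1` F)))%E.
Proof.
move=> ij mE mF.
have H := @mutually_independent3 _ _ _ P _ _ (inl tt) (inr (inl i))
  (inr (inl j)) (N K @^-1` U) (A0 i @^-1` E) (A0 j @^-1` F) (@indep K).
by apply: H => //; do ?[exact: ij|exact: sigma_count|exact: sigma_gain].
Qed.

Let indep1 K U i j E F : i != j -> measurable E -> measurable F ->
  P (N K @^-1` U `&` (A1 i @^-1` E `&` A1 j @^-1` F)) =
  (P (N K @^-1` U) * (P (A1 i @^-1` E) * P (A1 j @^-1` F)))%E.
Proof.
move=> ij mE mF.
have H := @mutually_independent3 _ _ _ P _ _ (inl tt) (inr (inr i))
  (inr (inr j)) (N K @^-1` U) (A1 i @^-1` E) (A1 j @^-1` F) (@indep K).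
by apply: H => //; do ?[exact: ij|exact: sigma_count|exact: sigma_gain].
Qed.

Lemma cvg_total_rate rho : 0 < rho ->
  cvg_in_probability P (total_rate g0 N A0 A1 rho)
    (rho * (tau + 1 - g0 * tau / (1 - expR (- tau)))).
Proof.
set c := rho * _; move=> rho0 e e0; have /andP[q0 q1] := p0_le1.
have /andP[g0_ge0 g0_le1] := g01.
have e20 : 0 < e / 2 by rewrite divr_gt0.
have M0 i := gain0_moments tau0 (A0density i).
have M1 j := gain1_moments tau0 (A1density j).
have r0 : 0 <= g0 * rho by rewrite mulr_ge0// ltW.
have r1 : 0 <= (1 - g0) * rho by rewrite mulr_ge0 ?subr_ge0// ltW.
have [C0 C00 tail0] := @ae_ge0_sum_ln_tail _ _ _ P A0 _ _
  (fun i => let: And3 x _ _ := M0 i in x)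
  (fun i => let: And3 _ x _ := M0 i in x)
  (fun i => let: And3 _ _ x := M0 i in x) _ _ r0 e20.
have [C1 C10 tail1] := @ae_ge0_sum_ln_tail _ _ _ P A1 _ _
  (fun i => let: And3 x _ _ := M1 i in x)
  (fun i => let: And3 _ x _ := M1 i in x)
  (fun i => let: And3 _ _ x := M1 i in x) _ _ r1 e20.
set m0 := 1 - _ in tail0; set m1 := tau + 1 in tail1.
(* Since [p0 tau + p1 tau = 1], the means satisfy [m1 - m0 = tau / p0 tau]. *)
have cE : c = g0 * rho * m0 + (1 - g0) * rho * m1.
  rewrite /c /m0 /m1 /p1 -/(p0 tau) /p0; field.
  exact: lt0r_neq0 q0.
pose V0 n := [set w | e / 2 <
  `|\sum_(i < n) ln (1 + g0 * rho / n%:R * A0 i w) - g0 * rho * m0|].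
pose V1 n := [set w | e / 2 <
  `|\sum_(i < n) ln (1 + (1 - g0) * rho / n%:R * A1 i w) -
    (1 - g0) * rho * m1|].
have mV0 n : measurable (V0 n).
  apply: measurable_gt_fun; apply: measurableT_comp => //.
  by apply: measurable_funB => //; exact: measurable_sum_ln.
have mV1 n : measurable (V1 n).
  apply: measurable_gt_fun; apply: measurableT_comp => //.
  by apply: measurable_funB => //; exact: measurable_sum_ln.
pose D := C0 / p0 tau + C1 / (1 - p0 tau).
have bound K : (P [set w | (e < `|total_rate g0 N A0 A1 rho K w - c|)%R]
    <= (D * harmonic K)%:E)%E.
  pose B k := N K @^-1` [set k].
  (* On [N K = k] both sums have deterministic lengths, and a total deviation above [e] forces one
     of them to deviate by more than [e / 2]. *)
  pose W k := B k `&` V0 k `|` B k `&` V1 (K - k)%N.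
  have mW k : measurable (W k).
    by apply: measurableU; apply: measurableI => //; exact: measurable_count.
  have PW k : (P (W k) <= (binomial_pmf K (p0 tau) k *
      (C0 / k.+1%:R + C1 / (K - k).+1%:R))%:E)%E.
    apply: le_trans (measureU2 _ _ _) _.
    - by apply: measurableI => //; exact: measurable_count.
    - by apply: measurableI => //; exact: measurable_count.
    rewrite mulrDr EFinD !EFinM -P_count; apply: leeD.
      apply: tail0; first exact: measurable_count.
      by move=> i j E F; exact: indep0.
    apply: tail1; first exact: measurable_count.
    by move=> i j E F; exact: indep1.
  (* The finite union of the [W k] misses the outcomes with [N K > K]; they form a null event. *)
  have P0 : P (N K @^-1` [set k | (K < k)%N]) = 0%E.
    rewrite -(@binomial_prob_gt _ K (p0 tau)) ?(ltW q0) ?(ltW q1)//.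
    by rewrite -Nbinom.
  have mbigW : measurable (\big[setU/set0]_(k < K.+1) W k).
    exact: bigsetU_measurable.
  apply: (@le_trans _ _ (P ((\big[setU/set0]_(k < K.+1) W k) `|`
      N K @^-1` [set k | (K < k)%N]))).
    rewrite le_measure ?inE//.
    - apply: measurable_gt_fun; apply: measurableT_comp => //.
      by apply: measurable_funB => //; exact: measurable_total_rate.
    - exact: measurableU.
    move=> w /= ew; have [|NK] := ltnP K (N K w); [by right|left].
    rewrite -bigcup_mkord; exists (N K w) => //.
    rewrite /W /B /V0 /V1 /=.
    have [h|h] := ltP (e / 2)
      `|\sum_(i < N K w) ln (1 + g0 * rho / (N K w)%:R * A0 i w) -
        g0 * rho * m0|.
      by left.
    right; split => //; move: ew; rewrite /total_rate cE => ew.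
    rewrite ltNge; apply/negP => h'; move: ew; apply/negP; rewrite -leNgt.
    by rewrite opprD addrACA (le_trans (ler_normD _ _))// [leRHS]splitr lerD.
  rewrite measureU0//; apply: le_trans (Boole_inequality _ _) _ => //.
  apply: (@le_trans _ _ (\sum_(k < K.+1) (binomial_pmf K (p0 tau) k *
      (C0 / k.+1%:R + C1 / (K - k).+1%:R))%:E)%E).
    by apply: lee_sum => k _; exact: PW.
  rewrite sumEFin lee_fin.
  under eq_bigr do rewrite mulrDr (mulrCA _ C0) (mulrCA _ C1).
  rewrite big_split/= -!mulr_sumr /D mulrDl.
  have -> : C0 / p0 tau * harmonic K = C0 * (K.+1%:R * p0 tau)^-1.
    by rewrite invfM [RHS]mulrA [RHS]mulrAC.
  have -> : C1 / (1 - p0 tau) * harmonic K = C1 * (K.+1%:R * (1 - p0 tau))^-1.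
    by rewrite invfM [RHS]mulrA [RHS]mulrAC.
  apply: lerD; apply: ler_wpM2l => //.
    by apply: sum_binomial_pmf_div; rewrite q0 ltW.
  by apply: sum_binomial_pmf_div_sub; rewrite q1 ltW.
apply: (@squeeze_cvge _ _ _ _ (cst 0%E) _ (fun K => (D * harmonic K)%:E)).
- by apply: nearW => K; rewrite measure_ge0 bound.
- exact: cvg_cst.
- apply: cvg_EFin; first exact: nearW.
  rewrite -[0](mulr0 D); apply: cvgM; first exact: cvg_cst.
  exact: cvg_harmonic.
Qed.

End total_rate.

Theorem proposition3 (R : realType) (d : measure_display)
    (T : measurableType d) (P : probability T R) (tau g0 : R)
    (N : nat -> {RV P >-> nat}) (A0 A1 : nat -> {RV P >-> R}) :
  0 < tau -> 0 <= g0 <= 1 ->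
  (forall (K : nat) (U : set nat),
     distribution P (N K) U = binomial_prob K (p0 tau) U) ->
  (forall i : nat, has_density (A0 i) (density0 tau)) ->
  (forall j : nat, has_density (A1 j) (density1 tau)) ->
  (forall K : nat, mutually_independent P (protocol_events (N K) A0 A1)) ->
  unique (wideband_min_energy_per_nat g0 N A0 A1)
    (tau + 1 - g0 * tau / (1 - expR (- tau)))^-1.
Proof.
move=> tau0 g01 Nbinom A0d A1d indep.
have cvgR rho := cvg_total_rate tau0 g01 Nbinom A0d A1d indep (rho := rho).
split; last first.
  (* The single power [rho = 1] already determines [eta], as the inverse of the limit in
     probability. *)
  move=> eta [eta0 /(_ 1 ltr01)]; rewrite div1r => cvg_eta.
  apply: invr_inj; rewrite invrK.
  have := cvgR 1 ltr01; rewrite mul1r => cvg1.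
  apply: (cvg_in_probability_unique _ cvg1 cvg_eta) => K.
  exact: measurable_total_rate.
split; last by move=> rho rho0; rewrite invrK; exact: cvgR.
rewrite invr_gt0 subr_gt0.
have q0 : 0 < 1 - expR (- tau) := p0_gt0 tau0.
rewrite ltr_pdivrMr//.
have /andP[g0_ge0 g0_le1] := g01.
(* The worst case is [g0 = 1], where positivity amounts to [1 + tau < expR tau]. *)
apply: le_lt_trans (_ : tau < _).
  by rewrite ger_pMl.
rewrite mulrBr mulr1 ltrBrDr addrC -ltrBrDr addrAC subrr add0r.
rewrite expRN ltr_pdivrMr ?expR_gt0// mul1r addrC.
by apply: expR_gt1Dx; rewrite lt0r_neq0.
Qed.
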